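(* Let $R$ be an associative ring with unit and let $M$ be a left $R$-module which is a progenerator of $\sigma[M]$. If $M$ is a semiprime Goldie module (both semiprime and Goldie), then for every $N\in\sigma[M]$ \[\mathcal{Z}(N)=\sum f(M),\] where the sum is over all morphisms $f:M\rightarrow N$ for which there exists a monomorphism $\alpha\in End_R(M)$ with $\alpha(M)\leq_e M$ and $f\alpha=0$.
   Context: Modules are unitary left $R$-modules. $\sigma[M]$ is the smallest full subcategory of $R$-Mod containing all modules isomorphic to a submodule of an $M$-generated module (a quotient of a direct sum of copies of $M$). $M$ is projective in $\sigma[M]$ if every morphism $M\to N$ lifts along every epimorphism $L\to N$ in $\sigma[M]$. ''Progenerator of $\sigma[M]$'' has its standard meaning: $M$ is finitely generated, projective in $\sigma[M]$, and a generator of $\sigma[M]$ (every module in $\sigma[M]$ is $M$-generated). $\leq_e$ denotes an essential submodule. A module $N\in\sigma[M]$ is $M$-singular if there is an exact sequence $0\to K\to L\to N\to 0$ in $\sigma[M]$ with $K\leq_e L$. The class $\mathcal{S}$ of $M$-singular modules is closed under submodules, quotients and direct sums, and $\mathcal{Z}(L)=\sum\{f(N)\mid N\in\mathcal{S},\ f\in Hom_R(N,L)\}$ is the largest $M$-singular submodule of $L\in\sigma[M]$. For submodules $K,L\leq M$, $K_ML=\sum\{f(K)\mid f\in Hom_R(M,L)\}$. A submodule $K\le M$ is fully invariant if $f(K)\le K$ for all $f\in End_R(M)$. $M$ is a semiprime module if for every fully invariant submodule $K\leq M$, $K_MK=0$ implies $K=0$. A left annihilator in $M$ is a submodule of the form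 $\bigcap\{Ker(f)\mid f\in X\}$ for some $X\subseteq End_R(M)$. $M$ is a Goldie module if it satisfies the ascending chain condition on left annihilators and has finite uniform dimension. *)

(* Defs.v *)
(* Submodules of [V] are classical sets [A : set V] satisfying [submodule]. *)
From HB Require Import structures.
From mathcomp Require Import all_boot all_order all_algebra.
From mathcomp Require Import boolp classical_sets functions cardinality.

Set Implicit Arguments.
Unset Strict Implicit.
Unset Printing Implicit Defensive.

Import GRing.Theory.
Local Open Scope classical_set_scope.
Local Open Scope ring_scope.

Definition submodule (R : pzRingType) (V : lmodType R) (A : set V) : Prop :=
  submod_closed (mem A).

Definition injective_lin (R : pzRingType) (V W : lmodType R)
  (f : {linear V -> W}) : Prop := injective f.

Definition surjective_lin (R : pzRingType) (V W : lmodType R)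
  (f : {linear V -> W}) : Prop := range f = setT.

Definition ker_lin (R : pzRingType) (V W : lmodType R)
  (f : {linear V -> W}) : set V := [set x | f x = 0].

(* The sum of a (possibly infinite) collection [F] of submodules: finite sums of
   elements of members of [F]. *)
Definition submodule_sum (R : pzRingType) (V : lmodType R)
    (F : set (set V)) : set V :=
  [set x | exists2 s : seq V, (forall y, y \in s -> exists2 A, F A & A y)
                            & x = \sum_(y <- s) y].

Definition essential (R : pzRingType) (V : lmodType R) (K : set V) : Prop :=
  submodule K /\
  forall A : set V, submodule A -> K `&` A = [set 0] -> A = [set 0].

(* The direct sum of copies of [V] indexed by [I]: the submodule of [I -> V] of
   the finitely supported functions. *)
Section DirectSum.
Variables (R : pzRingType) (I : Type) (V : lmodType R).

Definition finsupp_pred : {pred I -> V} :=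
  fun f => `[< finite_set [set i | f i != 0] >].

Fact finsupp_submod_closed : submod_closed finsupp_pred.
Proof.
split=> [|a f g /asboolP ff /asboolP fg]; apply/asboolP.
  by apply: (sub_finite_set _ (finite_set0 I)) => i /=; rewrite eqxx.
apply: (sub_finite_set (B := [set i | f i != 0] `|` [set i | g i != 0])).
  move=> i /=; have [f0|] := eqVneq (f i) 0; last by left.
  have [g0|] := eqVneq (g i) 0; last by right.
  suff -> : (a *: f + g) i = 0 by rewrite eqxx.
  by change (a *: f i + g i = 0); rewrite f0 g0 scaler0 addr0.
by rewrite finite_setU.
Qed.

HB.instance Definition _ :=
  GRing.isSubmodClosed.Build R (I -> V) finsupp_pred finsupp_submod_closed.

Record direct_sum : Type := DirectSum {
  dsum_fun :> I -> V;
  dsum_funP : dsum_fun \in finsupp_pred }.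

HB.instance Definition _ := [isSub for dsum_fun].
HB.instance Definition _ := [Choice of direct_sum by <:].
HB.instance Definition _ := [SubChoice_isSubLmodule of direct_sum by <:].

End DirectSum.

Definition generated (R : pzRingType) (M N : lmodType R) : Prop :=
  exists (I : Type) (p : {linear direct_sum I M -> N}), surjective_lin p.

Definition in_sigma (R : pzRingType) (M N : lmodType R) : Prop :=
  exists (L : lmodType R) (i : {linear N -> L}),
    generated M L /\ injective_lin i.

Definition finitely_generated (R : pzRingType) (M : lmodType R) : Prop :=
  exists (n : nat) (g : 'I_n -> M),
    forall x : M, exists c : 'I_n -> R, x = \sum_(k < n) c k *: g k.

Definition projective_in_sigma (R : pzRingType) (M : lmodType R) : Prop :=
  forall (L N : lmodType R), in_sigma M L -> in_sigma M N ->
  forall g : {linear L -> N}, surjective_lin g ->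
  forall f : {linear M -> N},
  exists h : {linear M -> L}, forall x, g (h x) = f x.

Definition generator_of_sigma (R : pzRingType) (M : lmodType R) : Prop :=
  forall N : lmodType R, in_sigma M N -> generated M N.

Definition progenerator (R : pzRingType) (M : lmodType R) : Prop :=
  [/\ finitely_generated M, projective_in_sigma M & generator_of_sigma M].

Definition M_singular (R : pzRingType) (M N : lmodType R) : Prop :=
  in_sigma M N /\
  exists (K L : lmodType R) (i : {linear K -> L}) (p : {linear L -> N}),
    [/\ in_sigma M K, in_sigma M L,
        [/\ injective_lin i, range i = ker_lin p & surjective_lin p]
      & essential (range i)].

(* The submodule $\mathcal{Z}(L)$. *)
Definition singular_submodule (R : pzRingType) (M L : lmodType R) : set L :=
  submodule_sum [set A | exists (N : lmodType R) (f : {linear N -> L}),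
                           M_singular M N /\ A = range f].

Arguments singular_submodule {R} M L.

(* $K_M L$; a morphism from [M] to the submodule [L] is an endomorphism of [M]
   whose image is contained in [L]. *)
Definition submodule_prod (R : pzRingType) (M : lmodType R)
    (K L : set M) : set M :=
  submodule_sum [set A | exists2 f : {linear M -> M},
                           range f `<=` L & A = f @` K].

Definition fully_invariant (R : pzRingType) (M : lmodType R)
    (K : set M) : Prop :=
  submodule K /\ forall f : {linear M -> M}, f @` K `<=` K.

Definition semiprime_module (R : pzRingType) (M : lmodType R) : Prop :=
  forall K : set M, fully_invariant K ->
    submodule_prod K K = [set 0] -> K = [set 0].

Definition left_annihilator (R : pzRingType) (M : lmodType R)
    (A : set M) : Prop :=
  exists X : set {linear M -> M}, A = \bigcap_(f in X) ker_lin f.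

Definition acc_left_annihilators (R : pzRingType) (M : lmodType R) : Prop :=
  forall A : nat -> set M, (forall n, left_annihilator (A n)) ->
    (forall n, A n `<=` A n.+1) ->
    exists n, forall m, (n <= m)%N -> A m = A n.

Definition uniform_submodule (R : pzRingType) (V : lmodType R)
    (U : set V) : Prop :=
  [/\ submodule U, U <> [set 0]
    & forall A B : set V, submodule A -> submodule B ->
        A `<=` U -> B `<=` U -> A `&` B = [set 0] ->
        A = [set 0] \/ B = [set 0]].

Definition independent (R : pzRingType) (V : lmodType R) (n : nat)
    (U : 'I_n -> set V) : Prop :=
  forall u : 'I_n -> V, (forall k, U k (u k)) -> \sum_(k < n) u k = 0 ->
    forall k, u k = 0.

(* [V] has uniform dimension [n]: some essential submodule is a direct sum of
   [n] uniform submodules. *)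
Definition has_uniform_dim (R : pzRingType) (V : lmodType R)
    (n : nat) : Prop :=
  exists U : 'I_n -> set V,
    [/\ forall k, uniform_submodule (U k), independent U
      & essential (submodule_sum (range U))].

Definition finite_uniform_dim (R : pzRingType) (V : lmodType R) : Prop :=
  exists n, has_uniform_dim V n.

Definition goldie_module (R : pzRingType) (M : lmodType R) : Prop :=
  acc_left_annihilators M /\ finite_uniform_dim M.

(* Main.v *)
(* The inclusion from right to left is direct: if [f alpha = 0], then [ker f]
   contains the essential submodule [alpha(M)], so [f(M)] is M-singular.
   Conversely let [p : L -> S] be an epimorphism with essential kernel.  As [L]
   is generated by [M], [S] is a sum of images of maps [p h] with [h : M -> L],
   and [ker (p h)] is essential in [M].  It remains to see that an essential
   submodule [E] of [M] contains [c(M)] for some monomorphism [c]; then [c(M)] is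
   automatically essential, because [M] has finite uniform dimension.

   This is Goldie's theorem for the semiprime ring [End(M)].  Levitzki's argument
   gives, in every nonzero submodule [A], the image of a non-nilpotent
   endomorphism, and a power [b] of it satisfies [ker b = ker b^2].  Starting with
   [c = 0], add to [c] such a [b] with image in the intersection of [E] and
   [ker c]; this keeps the intersection of [ker c] and [c(M)] zero and
   strictly decreases [ker c].  The successive images are independent, so the process stops at a
   monomorphism. *)
Require Import Defs.
From HB Require Import structures.
From mathcomp Require Import all_boot all_order all_algebra.
From mathcomp Require Import boolp classical_sets functions cardinality fsbigop.

Set Implicit Arguments.
Unset Strict Implicit.
Unset Printing Implicit Defensive.

Import GRing.Theory.
Local Open Scope classical_set_scope.
Local Open Scope ring_scope.

(** * Submodules, essential submodules and sums of submodules *)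

Lemma submoduleP (R : pzRingType) (V : lmodType R) (A : set V) :
  submodule A <-> A 0 /\ forall a u v, A u -> A v -> A (a *: u + v).
Proof.
split=> [[A0 Alin]|[A0 Alin]]; split.
- exact/set_mem.
- by move=> a u v Au Av; apply/set_mem; apply: Alin; apply/mem_set.
- exact/mem_set.
- by move=> a u v /set_mem Au /set_mem Av; apply/mem_set; apply: Alin.
Qed.

Section Submodules.
Variables (R : pzRingType) (V : lmodType R).

Lemma submodule0 (A : set V) : submodule A -> A 0.
Proof. by case/submoduleP. Qed.

Lemma submoduleD (A : set V) (u v : V) : submodule A -> A u -> A v -> A (u + v).
Proof. by case/submoduleP=> _ Alin Au Av; rewrite -[u]scale1r; apply: Alin. Qed.

Lemma submoduleZ (A : set V) (a : R) (u : V) : submodule A -> A u -> A (a *: u).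
Proof. by case/submoduleP=> A0 Alin Au; rewrite -[_ *: _]addr0; apply: Alin. Qed.

Lemma submoduleN (A : set V) (u : V) : submodule A -> A u -> A (- u).
Proof. by move=> Asub Au; rewrite -scaleN1r; apply: submoduleZ. Qed.

Lemma submoduleI (A B : set V) : submodule A -> submodule B -> submodule (A `&` B).
Proof.
move=> As Bs; apply/submoduleP; split; first by split; apply: submodule0.
by move=> a u v [Au Bu] [Av Bv]; split; apply: submoduleD => //; apply: submoduleZ.
Qed.

Lemma submodule_cyclic (x : V) : submodule (range (fun r : R => r *: x)).
Proof.
apply/submoduleP; split; first by exists 0; rewrite ?scale0r.
by move=> a _ _ [r _ <-] [s _ <-]; exists (a * r + s); rewrite // scalerDl scalerA.
Qed.

Lemma submodule_eq0 (A : set V) :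
  submodule A -> (forall x, A x -> x = 0) -> A = [set 0].
Proof.
move=> As A0; apply/seteqP; split=> [x /A0 //|x /= ->]; exact: submodule0.
Qed.

Lemma submodule_neq0 (A : set V) :
  submodule A -> A <> [set 0] -> exists2 x, A x & x <> 0.
Proof.
move=> As An0; apply: contrapT => Nex; apply: An0; apply: submodule_eq0 => // x Ax.
by apply: contrapT => xn0; apply: Nex; exists x.
Qed.

(** An essential submodule meets the nonzero cyclic submodule generated by [x]. *)
Lemma essential_scale (K : set V) (x : V) :
  essential K -> x <> 0 -> exists2 r : R, K (r *: x) & r *: x <> 0.
Proof.
move=> [Ks Kess] xn0.
have := Kess _ (submodule_cyclic x).
move=> Kx; have /submodule_neq0 : K `&` range (fun r : R => r *: x) <> [set 0].
  move=> /Kx cx0; apply: xn0.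
  have : range (fun r : R => r *: x) x by exists 1; rewrite ?scale1r.
  by rewrite cx0.
case; first by apply: submoduleI => //; apply: submodule_cyclic.
by move=> y [Ky [r _ ryE]] yn0; exists r; rewrite ryE.
Qed.

Lemma essentialW (K L : set V) :
  essential K -> submodule L -> K `<=` L -> essential L.
Proof.
move=> [Ks Kess] Ls KL; split=> // A As LA0; apply: Kess => //.
apply: submodule_eq0 => [|x [Kx Ax]]; first exact: submoduleI.
have : (L `&` A) x by split=> //; apply: KL.
by rewrite LA0.
Qed.

Lemma submodule_sum_sum (F : set (set V)) (s : seq V) :
  (forall y, y \in s -> submodule_sum F y) -> submodule_sum F (\sum_(y <- s) y).
Proof.
elim: s => [|y s IHs] sF; first by exists [::] => //; rewrite !big_nil.
have [t tF yE] := sF y (mem_head y s).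
have [|u uF sE] := IHs; first by move=> z zs; apply: sF; rewrite inE zs orbT.
exists (t ++ u); last by rewrite big_cons big_cat /= -yE -sE.
by move=> z; rewrite mem_cat => /orP[/tF|/uF].
Qed.

Lemma submodule_sum_mem (F : set (set V)) (A : set V) (x : V) :
  F A -> A x -> submodule_sum F x.
Proof.
move=> FA Ax; exists [:: x]; last by rewrite big_seq1.
by move=> y; rewrite inE => /eqP ->; exists A.
Qed.

Lemma submodule_submodule_sum (F : set (set V)) :
  (forall A, F A -> submodule A) -> submodule (submodule_sum F).
Proof.
move=> Fs; apply/submoduleP; split; first by exists [::] => //; rewrite big_nil.
move=> a u v [s sF ->] Fv.
have Fas : submodule_sum F (\sum_(y <- [seq a *: y | y <- s]) y).
  apply: submodule_sum_sum => _ /mapP[y ys ->]; have [A FA Ay] := sF y ys.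
  by apply: (submodule_sum_mem FA); apply: submoduleZ => //; apply: Fs.
rewrite big_map -scaler_sumr in Fas.
have := @submodule_sum_sum F [:: a *: (\sum_(y <- s) y); v].
rewrite big_cons big_seq1; apply=> y.
by rewrite !inE => /orP[/eqP ->|/eqP ->].
Qed.

End Submodules.

(** * Kernels, images and preimages under linear maps *)

Section LinearMaps.
Variables (R : pzRingType) (V W : lmodType R).

Lemma submodule_ker (f : {linear V -> W}) : submodule (ker_lin f).
Proof.
apply/submoduleP; split; first exact: linear0.
by move=> a u v fu fv; rewrite /ker_lin /= linearP fu fv scaler0 addr0.
Qed.

Lemma submodule_image (f : {linear V -> W}) (A : set V) :
  submodule A -> submodule (f @` A).
Proof.
move=> As; apply/submoduleP; split.
  by exists 0; rewrite ?linear0 //; apply: submodule0.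
move=> a _ _ [x Ax <-] [y Ay <-]; exists (a *: x + y); last by rewrite linearP.
by apply: submoduleD => //; apply: submoduleZ.
Qed.

Lemma submodule_range (f : {linear V -> W}) : submodule (range f).
Proof. by apply: submodule_image; apply/submoduleP. Qed.

Lemma submodule_preimage (f : {linear V -> W}) (K : set W) :
  submodule K -> submodule (f @^-1` K).
Proof.
move=> Ks; apply/submoduleP; split; first by rewrite /preimage /= linear0; exact: submodule0.
move=> a u v fu fv; rewrite /preimage /= linearP.
by apply: (submoduleD Ks) => //; apply: (submoduleZ _ Ks).
Qed.

(** A nonzero [x] either lies in the kernel, hence in the preimage, or has a multiple with
    [f (r *: x)] nonzero in [K]. *)
Lemma essential_preimage (f : {linear V -> W}) (K : set W) :
  essential K -> essential (f @^-1` K).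
Proof.
move=> Kess; have Ks := Kess.1.
split=> [|A As fKA0]; first exact: submodule_preimage.
apply: submodule_eq0 => // x Ax; apply: contrapT => xn0.
have [fx0|fxn0] := pselect (f x = 0).
  have : (f @^-1` K `&` A) x by split=> //; rewrite /preimage /= fx0; exact: (submodule0 Ks).
  by rewrite fKA0.
have [r Krfx rfxn0] := essential_scale Kess fxn0.
have : (f @^-1` K `&` A) (r *: x).
  by split; [rewrite /preimage /= linearZ|apply: submoduleZ].
by rewrite fKA0 => /= rx0; apply: rfxn0; rewrite -linearZ rx0 linear0.
Qed.

End LinearMaps.

(** * Submodules as modules in their own right *)

Section SubmoduleType.
Variables (R : pzRingType) (V : lmodType R) (A : set V).

(** Carrying the proof [As] as a parameter lets the closure properties be inferred from the
    predicate, so that [submodule_type As] becomes an [lmodType]. *)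
Definition submodule_pred (As : submodule A) : {pred V} := mem A.

HB.instance Definition _ (As : submodule A) :=
  GRing.isSubmodClosed.Build R V (submodule_pred As)
    (As : submod_closed (submodule_pred As)).

Record submodule_type (As : submodule A) : Type := SubmoduleType {
  submodule_val :> V;
  submodule_valP : submodule_val \in submodule_pred As }.

HB.instance Definition _ (As : submodule A) := [isSub for @submodule_val As].
HB.instance Definition _ (As : submodule A) :=
  [Choice of submodule_type As by <:].
HB.instance Definition _ (As : submodule A) :=
  [SubChoice_isSubLmodule of submodule_type As by <:].

Variable As : submodule A.

Definition submodule_incl : {linear submodule_type As -> V} := \val.

Lemma submodule_incl_inj : injective_lin submodule_incl.
Proof. exact: val_inj. Qed.

Lemma submodule_inclP (x : submodule_type As) : A (submodule_incl x).
Proof. exact: (set_mem (submodule_valP x)). Qed.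

Lemma range_submodule_incl : range submodule_incl = A.
Proof.
apply/seteqP; split=> [_ [x _ <-]|x Ax]; first exact: submodule_inclP.
by exists (@SubmoduleType As x (mem_set Ax)).
Qed.

Variables (U : lmodType R) (f : {linear U -> V}) (fA : forall x, A (f x)).

Definition corestriction (x : U) : submodule_type As :=
  @SubmoduleType As (f x) (mem_set (fA x)).

Lemma corestriction_is_linear : linear corestriction.
Proof. by move=> a x y; apply: val_inj; rewrite /= linearP. Qed.

HB.instance Definition _ := GRing.isLinear.Build R U (submodule_type As) _
  corestriction corestriction_is_linear.

End SubmoduleType.

(** * Injections, projections and the universal property of direct sums *)

Section DirectSumTheory.
Variables (R : pzRingType) (I : Type) (V W : lmodType R).

Lemma dsum_funD (x y : direct_sum I V) (i : I) : (x + y) i = x i + y i.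
Proof. by []. Qed.

Lemma dsum_funN (x : direct_sum I V) (i : I) : (- x) i = - x i.
Proof. by []. Qed.

Lemma dsum_funZ (a : R) (x : direct_sum I V) (i : I) : (a *: x) i = a *: x i.
Proof. by []. Qed.

Lemma dsum_eqP (x y : direct_sum I V) : (forall i, x i = y i) -> x = y.
Proof. by move=> xy; apply: val_inj; apply/funext => i; apply: xy. Qed.

Lemma dsum_finite_supp (x : direct_sum I V) : finite_set [set i | x i != 0].
Proof. exact/asboolP/dsum_funP. Qed.

Definition dsum_inj_fun (i : I) (v : V) (j : I) : V :=
  if pselect (j = i) then v else 0.

Lemma dsum_inj_subproof (i : I) (v : V) : dsum_inj_fun i v \in finsupp_pred (V := V).
Proof.
apply/asboolP; apply: (sub_finite_set (B := [set i])) (finite_set1 i).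
move=> j /=; rewrite /dsum_inj_fun; case: (pselect (j = i)) => [//|ji].
by move/eqP.
Qed.

Definition dsum_inj (i : I) (v : V) : direct_sum I V :=
  DirectSum (dsum_inj_subproof i v).

Lemma dsum_injE (i : I) (v : V) : dsum_inj i v i = v.
Proof. by rewrite /= /dsum_inj_fun; case: pselect. Qed.

Lemma dsum_inj_neq (i j : I) (v : V) : j <> i -> dsum_inj i v j = 0.
Proof. by rewrite /= /dsum_inj_fun; case: pselect. Qed.

Lemma dsum_inj_is_linear (i : I) : linear (dsum_inj i).
Proof.
move=> a u v; apply: dsum_eqP => j; rewrite dsum_funD dsum_funZ.
have [->|ji] := pselect (j = i); first by rewrite !dsum_injE.
by rewrite !dsum_inj_neq // scaler0 addr0.
Qed.

HB.instance Definition _ (i : I) := GRing.isLinear.Build R V (direct_sum I V) _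
  (dsum_inj i) (dsum_inj_is_linear i).

Definition dsum_proj (i : I) (x : direct_sum I V) : V := x i.

Lemma dsum_proj_is_linear (i : I) : linear (dsum_proj i).
Proof. by []. Qed.

HB.instance Definition _ (i : I) := GRing.isLinear.Build R (direct_sum I V) V _
  (dsum_proj i) (dsum_proj_is_linear i).

(** Induction on a sequence covering the support: subtracting the coordinate at its head leaves an
    element supported on the tail. *)
Lemma dsum_ind (P : direct_sum I V -> Prop) :
    P 0 -> (forall x y, P x -> P y -> P (x + y)) ->
    (forall i v, P (dsum_inj i v)) -> forall x, P x.
Proof.
move=> P0 PD Pinj x.
have [s] := (finite_seqP [set i : {classic I} | x i != 0]).1 (dsum_finite_supp x).
move=> /seteqP[xs _].
have {xs} : forall i : {classic I}, x i != 0 -> i \in s by [].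
elim: s x => [x x0|i s IHs x xs].
  suff -> : x = 0 by [].
  by apply: dsum_eqP => i; apply/eqP; apply: contrapT => /negP/x0.
rewrite -[x](subrK (dsum_inj i (x i))); apply: PD => //; apply: IHs => j.
have [->|ji] := pselect (j = i).
  by rewrite dsum_funD dsum_funN dsum_injE subrr eqxx.
rewrite dsum_funD dsum_funN dsum_inj_neq // subr0 => /xs.
by rewrite inE => /orP[/eqP|].
Qed.

Variable F : I -> {linear V -> W}.

(** The map out of the direct sum induced by the family [F]. The index type is arbitrary, so
    [{classic I}] supplies the choice structure needed by sums of finite support. *)
Definition dsum_map (x : direct_sum I V) : W :=
  \sum_(i \in [set: {classic I}]) F i (x i).

(** Allowing any finite [A] that contains the support lets [x], [y] and [a *: x + y] be summed over
    one common index set. *)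
Lemma dsum_mapE (A : set {classic I}) (x : direct_sum I V) :
  finite_set A -> (forall i, x i != 0 -> A i) ->
  dsum_map x = \sum_(i <- finmap.enum_fset (fset_set A)) F i (x i).
Proof.
move=> Afin xA; rewrite -fsbig_finite //; symmetry; apply: fsbig_widen => // i [_ nAi].
by rewrite /preimage /=; have [->|/xA] := eqVneq (x i) 0; rewrite ?linear0.
Qed.

Lemma dsum_map_is_linear : linear dsum_map.
Proof.
move=> a x y.
pose A : set {classic I} := [set i | x i != 0] `|` [set i | y i != 0].
have Afin : finite_set A by rewrite finite_setU; split; apply: dsum_finite_supp.
rewrite !(dsum_mapE Afin) ?scaler_sumr -?big_split /=.
- by apply: eq_bigr => i _; rewrite linearP.
- by move=> i; right.
- by move=> i; left.
move=> i; change (a *: x i + y i != 0 -> A i).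
have [x0|] := eqVneq (x i) 0; last by left.
have [y0|] := eqVneq (y i) 0; last by right.
by rewrite x0 y0 scaler0 addr0 eqxx.
Qed.

HB.instance Definition _ := GRing.isLinear.Build R (direct_sum I V) W _
  dsum_map dsum_map_is_linear.

Lemma dsum_map_inj (i : I) (v : V) : dsum_map (dsum_inj i v) = F i v.
Proof.
rewrite (@dsum_mapE [set i : {classic I}]); last 2 first.
- exact: finite_set1.
- by move=> j; have [->|ji] := pselect (j = i); rewrite // dsum_inj_neq ?eqxx.
by rewrite -fsbig_finite // fsbig_set1 dsum_injE.
Qed.

End DirectSumTheory.

(** * Generation and projectivity in the category sigma[M], and semiprimeness in terms of
    endomorphisms *)

Section Sigma.
Variables (R : pzRingType) (M : lmodType R).

Lemma in_sigma_generated (N : lmodType R) : generated M N -> in_sigma M N.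
Proof. by move=> Ngen; exists N, idfun; split=> // x y. Qed.

Lemma in_sigma_dsum (I : Type) : in_sigma M (direct_sum I M).
Proof.
apply: in_sigma_generated; exists I, idfun.
by apply/seteqP; split=> // x _; exists x.
Qed.

Lemma in_sigma_inj (N L : lmodType R) (i : {linear N -> L}) :
  injective_lin i -> in_sigma M L -> in_sigma M N.
Proof.
move=> iinj [P [j [Pgen jinj]]].
exists P, (j \o i); split=> //.
exact: inj_comp.
Qed.

Lemma in_sigma_self : in_sigma M M.
Proof.
apply: (@in_sigma_inj _ _ (dsum_inj tt)) (in_sigma_dsum unit).
by move=> u v /(congr1 (fun x : direct_sum unit M => x tt)); rewrite !dsum_injE.
Qed.

Hypothesis genM : generator_of_sigma M.

(** [N] is a quotient of a direct sum of copies of [M], so additive properties need checking only on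
    images of maps from [M]. *)
Lemma generator_ind (N : lmodType R) (P : N -> Prop) :
    in_sigma M N -> P 0 -> (forall u v, P u -> P v -> P (u + v)) ->
    (forall (f : {linear M -> N}) m, P (f m)) -> forall x, P x.
Proof.
move=> /genM[I [p psurj]] P0 PD Pf x.
have : range p x by rewrite psurj.
case=> y _ <-; elim/dsum_ind: y => [|y z|i m]; rewrite ?linear0 ?linearD //.
  exact: PD.
exact: (Pf (p \o dsum_inj i)).
Qed.

(** [A] embeds in [M], so it is generated by [M]; if all maps from [M] to [A] were zero, so would be
    [A]. *)
Lemma generator_hom_neq0 (A : set M) :
  submodule A -> A <> [set 0] ->
  exists2 a : {linear M -> M}, range a `<=` A & exists x, a x <> 0.
Proof.
move=> As /(submodule_neq0 As)[x Ax xn0]; apply: contrapT => Nex; apply: xn0.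
have sA : in_sigma M (submodule_type As).
  exact: in_sigma_inj (@submodule_incl_inj _ _ _ As) in_sigma_self.
have : range (submodule_incl As) x by rewrite range_submodule_incl.
case=> z _ <-.
apply: (generator_ind (P := fun z => submodule_incl As z = 0) sA) => [|u v u0 v0|f m].
- by rewrite linear0.
- by rewrite linearD u0 v0 addr0.
- apply: contrapT => fm0; apply: Nex.
  exists (submodule_incl As \o f); last by exists m.
  by move=> _ [y _ <-]; apply: submodule_inclP.
Qed.

Hypothesis projM : projective_in_sigma M.
Hypothesis semiprimeM : semiprime_module M.

(** Semiprimeness passes from [M] to its endomorphism ring. Projectivity serves to express any map
    from [M] into the fully invariant submodule generated by [a(M)] through maps of the form
    [v a h]. *)
Lemma semiprime_end (a : {linear M -> M}) :
  (forall (s : {linear M -> M}) x, a (s (a x)) = 0) -> forall x, a x = 0.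
Proof.
move=> asa.
pose F : set (set M) := [set A | exists s : {linear M -> M}, A = range (s \o a)].
(* [K] is the sum of all [s(a(M))], a fully invariant submodule containing [a(M)]; it is shown that
   its product with itself is zero. *)
pose K := submodule_sum F.
have Ks : submodule K.
  by apply: submodule_submodule_sum => _ [s ->]; apply: (submodule_range (s \o a)).
have KE (s : {linear M -> M}) x : K (s (a x)).
  by apply: (@submodule_sum_mem _ _ F (range (s \o a))); [exists s|exists x].
have K0 : K = [set 0].
  apply: semiprimeM.
    split=> // f _ [_ [s sF ->] <-]; rewrite linear_sum /=.
    rewrite big_seq; apply: (big_ind K) => //; first exact: submodule0.
      by move=> u v; apply: submoduleD.
    move=> y /sF[_ [t ->] [x _ <-]]; exact: (KE (f \o t)).
  apply: submodule_eq0.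
    by apply: submodule_submodule_sum => _ [f _ ->]; apply: submodule_image.
  move=> x [s sK ->]; rewrite big_seq; apply: big1 => y /sK[_ [f fK ->]].
  move=> [_ [t tF ->] <-]; rewrite linear_sum big_seq; apply: big1 => z.
  move=> /tF[_ [u ->] [w _ <-]] /=.
  (* The maps [v a], for all endomorphisms [v], together map a direct sum of copies of [M] onto [K];
     [f] is then lifted along this epimorphism. *)
  pose Fa (v : {linear M -> M}) : {linear M -> submodule_type Ks} :=
    @corestriction _ _ _ Ks _ (v \o a) (KE v).
  have psurj : surjective_lin (dsum_map Fa).
    apply/seteqP; split=> // k _.
    have : K (submodule_incl Ks k) by apply: submodule_inclP.
    case=> r rF kE.
    suff [d _ dE] : range (submodule_incl Ks \o dsum_map Fa) (submodule_incl Ks k).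
      by exists d => //; apply: submodule_incl_inj.
    rewrite kE big_seq; apply: (big_ind (range _)).
    - exact: submodule0 (submodule_range (submodule_incl Ks \o dsum_map Fa)).
    - by move=> c d; apply: submoduleD (submodule_range (submodule_incl Ks \o dsum_map Fa)).
    by move=> z' /rF[_ [v ->] [m _ <-]]; exists (dsum_inj v m); rewrite //= dsum_map_inj.
  have fK' y' : K (f y') by apply: fK; exists y'.
  have [h hE] := projM (in_sigma_dsum _)
     (in_sigma_inj (@submodule_incl_inj _ _ _ Ks) in_sigma_self)
     psurj (corestriction Ks fK').
  have {hE} := congr1 (submodule_incl Ks) (hE (u (a w))).
  (* With [h] the lift of [f], the element [f (u (a w))] is the sum of the terms
     [v (a (h_v (u (a w))))], each zero by the hypothesis on [a] applied to [h_v u]. *)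
  move=> /= <-; rewrite [dsum_map _ _]fsbig1 // => v _.
  apply: val_inj => /=.
  by rewrite -[h _ v]/((dsum_proj v \o h \o u) (a w)) asa linear0.
move=> x; have : K (a x) by exact: (KE idfun).
by rewrite K0.
Qed.
End Sigma.

Lemma dependent_choice (T : Type) (P : T -> Prop) (r : T -> T -> Prop) (x0 : T) :
  P x0 -> (forall x, P x -> exists2 y, P y & r x y) ->
  exists u : nat -> T, forall n, P (u n) /\ r (u n) (u n.+1).
Proof.
move=> Px0 next.
have [x|f fP] := @choice T T (fun x y => P x -> P y /\ r x y).
  (* Outside [P] nothing is demanded of the successor, and [x] itself is a default. *)
  have [Px|nPx] := pselect (P x); last by exists x.
  by have [y Py rxy] := next x Px; exists y.
exists (fun n => iter n f x0) => n.
have Pn : P (iter n f x0) by elim: n => //= n /fP[].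
by split=> //; case: (fP _ Pn).
Qed.

(** * Finite uniform dimension excludes infinite direct sums *)

Section UniformDimension.
Variables (R : pzRingType) (V : lmodType R).

(* The cyclic submodules generated by the [x k] form an infinite direct sum,
   [T k] being a submodule that contains [x i] for all [i >= k]. *)
Definition complement_chain (T : nat -> set V) (x : nat -> V) : Prop :=
  forall k, [/\ submodule (T k), T k.+1 `<=` T k, T k (x k), x k <> 0
    & forall r, T k.+1 (r *: x k) -> r *: x k = 0].

(** The sum of the first [j] submodules, written with families over all of ['I_n] that vanish from
    [j] on, so that the index type stays fixed while [j] decreases. *)
Definition partial_sum (n : nat) (U : 'I_n -> set V) (j : nat) (x : V) : Prop :=
  exists u : 'I_n -> V, [/\ forall i, U i (u i),
    forall i : 'I_n, (j <= i)%N -> u i = 0 & x = \sum_(i < n) u i].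

Lemma partial_sum_full (n : nat) (U : 'I_n -> set V) (x : V) :
  (forall i, submodule (U i)) -> submodule_sum (range U) x -> partial_sum U n x.
Proof.
move=> Us [s sU ->]; elim: s sU => [|y s IHs] sU.
  exists (fun=> 0); split=> // [i|]; first exact: submodule0.
  by rewrite big_nil big1.
have [|u [uU _ sE]] := IHs; first by move=> z zs; apply: sU; rewrite inE zs orbT.
have [_ [i _ <-] Uiy] := sU y (mem_head y s).
exists (fun k => (if k == i then y else 0) + u k); split=> [k|k|].
- by apply: submoduleD => //; case: eqP => [->|_] //; apply: submodule0.
- by rewrite leqNgt ltn_ord.
by rewrite big_cons big_split /= -big_mkcond big_pred1_eq -sE.
Qed.

(* A combination of [x (2k)] and [x (2k+1)] cancels the component in the uniform
   submodule [U j]. *)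
Lemma complement_chain_refine (n : nat) (U : 'I_n -> set V) (j : nat)
    (T : nat -> set V) (x : nat -> V) (k : nat) :
  (forall i, uniform_submodule (U i)) -> independent U -> (j < n)%N ->
  complement_chain T x -> (forall i, partial_sum U j.+1 (x i)) ->
  exists2 y, partial_sum U j y & [/\ T k.*2 y, y <> 0
    & forall r, T k.+1.*2 (r *: y) -> r *: y = 0].
Proof.
move=> Uunif Uind jn Tx xU; set ij := Ordinal jn.
have Us i : submodule (U i) by case: (Uunif i).
have [T0s T10 T0x x0 T0P] := Tx k.*2.
have [T1s T21 T1x x1 T1P] := Tx k.*2.+1.
set c := x k.*2 in T0x x0 T0P *; set d := x k.*2.+1 in T1x x1 T1P *.
have [u [uU uj cE]] := xU k.*2; have [v [vU vj dE]] := xU k.*2.+1.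
rewrite -/c in cE; rewrite -/d in dE.
have ltj (w : 'I_n -> V) : (forall i : 'I_n, (j < i)%N -> w i = 0) -> w ij = 0 ->
    forall i : 'I_n, (j <= i)%N -> w i = 0.
  move=> wj wij i; rewrite leq_eqVlt => /orP[/eqP ji|/wj //].
  by suff -> : i = ij by []; apply: val_inj.
have [uij0|uij0] := pselect (u ij = 0).
  exists c; first by exists u; split=> //; apply: ltj.
  by split=> // r /T21 rc; apply: T0P.
have [vij0|vij0] := pselect (v ij = 0).
  exists d; first by exists v; split=> //; apply: ltj.
  by split=> //; apply: T10.
have cyc0 (w : V) : w <> 0 -> range (fun r : R => r *: w) <> [set 0].
  move=> w0 w00; apply: w0.
  have : range (fun r : R => r *: w) w by exists 1; rewrite ?scale1r.
  by rewrite w00.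
have cycU (w : V) : U ij w -> range (fun r : R => r *: w) `<=` U ij.
  by move=> Uw _ [r _ <-]; apply: submoduleZ.
(* Both components in [U j] are nonzero, so by uniformity they have a common nonzero multiple
   [z]. *)
have /submodule_neq0[] :
    range (fun r : R => r *: u ij) `&` range (fun r : R => r *: v ij) <> [set 0].
  have [_ _ unif] := Uunif ij.
  by case/(unif _ _ (submodule_cyclic _) (submodule_cyclic _)
      (cycU _ (uU ij)) (cycU _ (vU ij))); apply: cyc0.
  by apply: submoduleI; apply: submodule_cyclic.
move=> z [[r _ rE] [s _ sE]] z0.
have rsc : r *: c - s *: d = \sum_(i < n) (r *: u i - s *: v i).
  by rewrite cE dE !scaler_sumr -sumrB.
exists (r *: c - s *: d).
  exists (fun i => r *: u i - s *: v i); split=> // [i|].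
    by apply: submoduleD => //; [|apply: submoduleN => //]; apply: submoduleZ.
  apply: ltj => [i ji|]; first by rewrite uj // vj // !scaler0 subrr.
  by rewrite rE sE subrr.
split=> [|rcsd|t T2t].
- apply: submoduleD => //; first exact: submoduleZ.
  by apply: submoduleN => //; apply: T10; apply: submoduleZ.
(* If [r c = s d], this element lies in [T k.*2.+1], so it vanishes; independence then kills its
   component [z]. *)
- have rc0 : r *: c = 0.
    by apply: T0P; rewrite (subr0_eq rcsd); apply: submoduleZ.
  apply: z0; rewrite -rE; apply: (Uind (fun i => r *: u i)).
    by move=> i; apply: submoduleZ.
  by rewrite -scaler_sumr -cE.
(* First [t r c], the sum of the given multiple and [t s d], lies in [T k.*2.+1] and vanishes; then
   [t s d] lies in [T k.*2.+2] and vanishes too. *)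
have trc0 : (t * r) *: c = 0.
  apply: T0P; rewrite -scalerA -[r *: c](subrK (s *: d)) scalerDr.
  by apply: submoduleD => //; [apply: T21|do 2!apply: submoduleZ => //].
move: T2t; rewrite scalerDr scalerA trc0 add0r -scaleNr scalerA.
exact: T1P.
Qed.

(** Each refinement removes one of the [n] uniform components from all vectors while merging them in
    pairs; the chain is infinite, so this can be repeated until the nonzero vectors have no
    component left. *)
Lemma no_complement_chain (T : nat -> set V) (x : nat -> V) :
  finite_uniform_dim V -> ~ complement_chain T x.
Proof.
case=> n [U [Uunif Uind Uess]] Tx.
have Us i : submodule (U i) by case: (Uunif i).
suff H j : (j <= n)%N -> forall T x, complement_chain T x ->
    ~ forall k, partial_sum U j (x k).
  (* Nonzero multiples of the [x k] still form a chain, and by essentiality they can be taken in the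
     sum of the [U i]. *)
  have xU k : exists r, partial_sum U n (r *: x k) /\ r *: x k <> 0.
    have [_ _ _ xk0 _] := Tx k.
    have [r rU r0] := essential_scale Uess xk0.
    by exists r; split=> //; apply: partial_sum_full.
  have [r rP] := choice xU.
  apply: (H n (leqnn n) T (fun k => r k *: x k)) => [k|k]; last by case: (rP k).
  have [Ts Tdec Tk _ TP] := Tx k.
  split=> //; [exact: submoduleZ|by case: (rP k)|].
  by move=> s; rewrite scalerA => /TP.
elim: j => [|j IHj] jn {T x Tx} T x Tx xU.
  have [_ _ _ x0 _] := Tx 0%N; apply: x0.
  by have [u [_ u0 ->]] := xU 0%N; apply: big1 => i _; apply: u0.
have /choice[y yP] : forall k, exists y, partial_sum U j y /\ [/\ T k.*2 y, y <> 0
    & forall r, T k.+1.*2 (r *: y) -> r *: y = 0].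
  by move=> k; have [y yU yP] := complement_chain_refine k Uunif Uind jn Tx xU; exists y.
apply: (IHj (ltnW jn) (fun k => T k.*2) y) => k; last by case: (yP k).
have [yU [Ty y0 yT]] := yP k.
have [Ts T1 _ _ _] := Tx k.*2; have [_ T2 _ _ _] := Tx k.*2.+1.
by split=> // z /T2 /T1.
Qed.

End UniformDimension.

(** * Goldie's theorem: essential submodules and monomorphisms *)

Section Goldie.
Variables (R : pzRingType) (M : lmodType R).
Implicit Types a b c f g s : {linear M -> M}.

(** If a nonzero [b] generated a submodule missing [a(M)], then [b], [a b], [a (a b)], ... would
    generate an infinite direct sum. *)
Lemma injective_lin_essential a :
  finite_uniform_dim M -> injective_lin a -> essential (range a).
Proof.
move=> fdM ainj; split=> [|B Bs aB0]; first exact: submodule_range.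
apply: contrapT => /(submodule_neq0 Bs)[b Bb b0].
pose T k := range (iter k a).
have iterL k r x : iter k a (r *: x) = r *: iter k a x.
  by elim: k => //= k ->; rewrite linearZ.
have iter_lin k : linear (iter k a).
  by elim: k => // k IHk r x y; rewrite /= IHk linearP.
have iter0 k : iter k a 0 = 0 by elim: k => //= k ->; rewrite linear0.
have iter_inj k : injective (iter k a).
  by elim: k => // k IHk x y /= /ainj /IHk.
apply: (@no_complement_chain _ _ T (fun k => iter k a b) fdM) => k; split.
- apply/submoduleP; split.
    by exists 0; rewrite ?iter0.
  by move=> r _ _ [x _ <-] [y _ <-]; exists (r *: x + y); rewrite ?iter_lin.
- by move=> _ [x _ <-]; exists (a x); rewrite -?iterSr.
- by exists b.
- move=> kb0; apply: b0; apply: (iter_inj k); by rewrite kb0 iter0.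
(* Cancelling the injective [k]-th power of [a] leaves [a x = r b], an element of [a(M)] and of
   [B]. *)
move=> r [x _]; rewrite iterSr -iterL => /iter_inj axE.
have : (range a `&` B) (r *: b) by split; [exists x|apply: submoduleZ].
by rewrite aB0 => /= ->; exact: iter0.
Qed.

Hypothesis accM : acc_left_annihilators M.

Lemma left_annihilator_ker a : left_annihilator (ker_lin a).
Proof. by exists [set a]; rewrite bigcap_set1. Qed.

(** Without a maximal kernel, dependent choice would give a strictly ascending chain of left
    annihilators. *)
Lemma acc_ker_max (P : {linear M -> M} -> Prop) a0 :
  P a0 -> exists2 a : {linear M -> M}, P a &
    forall b, P b -> ker_lin a `<=` ker_lin b -> ker_lin b `<=` ker_lin a.
Proof.
move=> Pa0; apply: contrapT => nomax.
have [|u uP] := @dependent_choice _ P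
    (fun a b => ker_lin a `<=` ker_lin b /\ ~ ker_lin b `<=` ker_lin a) _ Pa0.
  move=> a Pa; apply: contrapT => nb; apply: nomax; exists a => // b Pb ab.
  by apply: contrapT => ba; apply: nb; exists b.
have [||n nP] := @accM (fun n => ker_lin (u n)).
- by move=> n; apply: left_annihilator_ker.
- by move=> n; case: (uP n) => _ [].
by case: (uP n) => _ [_]; apply; rewrite nP.
Qed.

(** The function [iter k a] bundled as a linear map, so that its kernel is a left annihilator. *)
Fixpoint lin_iter (k : nat) a : {linear M -> M} :=
  if k is k'.+1 then a \o lin_iter k' a else idfun.

Lemma lin_iterE (k : nat) a x : lin_iter k a x = iter k a x.
Proof. by elim: k => //= k ->. Qed.

Hypothesis progM : progenerator M.
Hypothesis semiprimeM : semiprime_module M.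

Let genM : generator_of_sigma M. Proof. by case: progM. Qed.
Let projM : projective_in_sigma M. Proof. by case: progM. Qed.

(* A nonzero element of the left ideal generated by [b] whose kernel is maximal
   satisfies [a s a = 0] for all [s] as soon as every [s b] is nilpotent. *)
Lemma exists_non_nilpotent (A : set M) :
  submodule A -> A <> [set 0] ->
  exists2 a : {linear M -> M}, range a `<=` A & forall k, exists x, iter k a x <> 0.
Proof.
move=> As A0; apply: contrapT => nonil.
have [b bA [x0 bx0]] := generator_hom_neq0 genM As A0.
(* The image of [b s] lies in [A], so [b s] is nilpotent by assumption, and [s b] with it, since its
   power [j+1] is [s], the [j]-th power of [b s] and [b] composed. *)
have nil s : exists k, forall x, iter k (s \o b) x = 0.
  apply: contrapT => sb; apply: nonil; exists (b \o s).
    by move=> _ [x _ <-]; apply: bA; exists (s x).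
  move=> k; apply: contrapT => nk; apply: sb; exists k.+1 => x.
  have E j y : iter j.+1 (s \o b) y = s (iter j (b \o s) (b y)).
    by elim: j => //= j <-.
  rewrite E; have -> : iter k (b \o s) (b x) = 0.
    by apply: contrapT => kx; apply: nk; exists (b x).
  by rewrite linear0.
pose P a := (exists s, forall x, a x = s (b x)) /\ exists x, a x <> 0.
have [|a [[t tE] [x1 ax1]] amax] := @acc_ker_max P b.
  by split; [exists idfun|exists x0].
apply: ax1. apply: (semiprime_end projM semiprimeM) => s x {x1}.
have [sx0|sx0] := pselect (forall x, s (a x) = 0); first by rewrite sx0 linear0.
have := nil (s \o t).
have eqst j y : iter j ((s \o t) \o b) y = iter j (s \o a) y.
  by elim: j => //= j ->; rewrite -tE.
case=> k0 k0P; have ex : exists k, `[< forall y, iter k (s \o a) y = 0 >].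
  by exists k0; apply/asboolP => y; rewrite -eqst.
(* Let [k+2] be the nilpotency index of [s a]. Its power [k+1] is nonzero, lies in the left ideal of
   [b] and kills [ker a], so by maximality it has the same kernel as [a]. That kernel contains
   [s (a x)]. *)
case: (ex_minnP ex) => -[|[|k]] /asboolP k_0 kmin.
- by have := k_0 (a x) => /= ->; rewrite !linear0.
- by case: sx0.
have : ker_lin (lin_iter k.+1 (s \o a)) (s (a x)).
  by rewrite /ker_lin /= -[RHS](k_0 x) lin_iterE -iterSr.
apply: amax.
  split; first by exists (lin_iter k (s \o a) \o s \o t) => y;
    rewrite lin_iterE iterSr /= -tE lin_iterE.
  apply: contrapT => nk; have := kmin k.+1; rewrite ltnn => H.
  suff : false by [].
  apply: H; apply/asboolP => y; apply: contrapT => ky; apply: nk.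
  by exists y; rewrite lin_iterE.
move=> y ay; change (lin_iter k.+1 (s \o a) y = 0).
by rewrite lin_iterE iterSr /= ay linear0 -lin_iterE linear0.
Qed.

(** The kernels of the powers of a non-nilpotent [a] become stationary at some [n]. The power [n+1]
    is taken, being positive, so that its image stays in [A]. *)
Lemma exists_ker_square (A : set M) :
  submodule A -> A <> [set 0] ->
  exists b : {linear M -> M}, [/\ range b `<=` A, forall x, b (b x) = 0 -> b x = 0
             & exists x, b x <> 0].
Proof.
move=> As /(exists_non_nilpotent As)[a aA anil].
have [||n nP] := @accM (fun n => ker_lin (lin_iter n a)).
- by move=> n; apply: left_annihilator_ker.
- by move=> n x; rewrite /ker_lin /= => ->; rewrite linear0.
exists (lin_iter n.+1 a); split=> [_ [x _ <-]|x|].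
- by apply: aA; eexists.
- rewrite !lin_iterE -iterD -!lin_iterE.
  have -> : (lin_iter (n.+1 + n.+1) a x = 0) =
      ker_lin (lin_iter (n.+1 + n.+1) a) x by [].
  rewrite nP ?addSnnS ?leq_addr // -(nP n.+1) //.
by have [x xP] := anil n.+1; exists x; rewrite lin_iterE.
Qed.

Hypothesis fdM : finite_uniform_dim M.

Lemma essential_contains_mono (E : set M) :
  essential E -> exists2 c : {linear M -> M}, injective_lin c & range c `<=` E.
Proof.
move=> Eess; have Es := Eess.1; apply: contrapT => nomono.
(* [P] is the invariant of the construction; [r] records the summand [b] added at each step. *)
pose P c := range c `<=` E /\ forall x, c (c x) = 0 -> c x = 0.
pose r c d := exists b : {linear M -> M}, [/\
  forall x, d x = c x + b x, forall x, c (b x) = 0,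
  forall x, b (b x) = 0 -> b x = 0 & exists x, b x <> 0].
have [||u uP] := @dependent_choice _ P r (\0 : {linear M -> M}).
- by split=> // _ [x _ <-]; apply: submodule0.
- move=> c [cE cc].
  have Ecs : submodule (E `&` ker_lin c) by apply: submoduleI => //; apply: submodule_ker.
  have [|b [bE bb bn0]] := exists_ker_square Ecs.
    (* If [E] meets [ker c] trivially, essentiality gives [ker c = 0] and [c] is the monomorphism
       sought. *)
    move=> Ec0; apply: nomono; exists c => //.
    have kc0 : ker_lin c = [set 0] by apply: Eess.2 => //; apply: submodule_ker.
    move=> x y cxy; apply/eqP; rewrite -subr_eq0; apply/eqP.
    have : ker_lin c (x - y) by rewrite /ker_lin /= linearB cxy subrr.
    by rewrite kc0.
  have cb x : c (b x) = 0 by have [] : (E `&` ker_lin c) (b x) by apply: bE; exists x.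
  exists (c \+ b); last by exists b.
  split=> [_ [x _ <-]|x /=].
    apply: submoduleD => //; first by apply: cE; exists x.
    by have [] : (E `&` ker_lin c) (b x) by apply: bE; exists x.
  rewrite !linearD cb addr0 => H.
  (* Applying [c] to [H] removes the terms in [b], leaving [c (c (c x)) = 0]. *)
  have cx0 : c x = 0.
    apply/cc/cc; rewrite -[RHS](linear0 c) -H !linearD !cb !addr0.
    by [].
  move: H; rewrite cx0 !linear0 !add0r; exact: bb.
pose Q k x := (exists b : {linear M -> M}, [/\
  forall y, u k.+1 y = u k y + b y, forall y, u k (b y) = 0,
  forall y, b (b y) = 0 -> b y = 0 & exists2 y, b y <> 0 & x = b y]).
have /choice[x xQ] : forall k, exists x, Q k x.
  by move=> k; have [_ [b [h1 h2 h3 [y y0]]]] := uP k; exists (b y), b; split=> //; exists y.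
apply: (@no_complement_chain _ _ (fun k => ker_lin (u k)) x fdM) => k.
(* The kernels decrease because applying [u k] to [u k z + b z = 0] gives [u k (u k z) = 0]. A
   multiple of [b y] in the next kernel is killed by [b], hence zero. *)
have [b [uE ub bb [y by0 xE]]] := xQ k; have [[_ uu] _] := uP k.
split; rewrite ?xE //.
- exact: submodule_ker.
- move=> z; rewrite /ker_lin /= uE => uz.
  apply: uu; have := congr1 (u k) uz.
  by rewrite linearD ub addr0 linear0.
by move=> t; rewrite -linearZ /ker_lin /= uE ub add0r => /bb.
Qed.

End Goldie.

(** * Description of the singular submodule *)

Lemma M_singular_range (R : pzRingType) (M N : lmodType R)
    (f : {linear M -> N}) :
  in_sigma M N -> essential (ker_lin f) ->
  M_singular M (submodule_type (submodule_range f)).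
Proof.
move=> sN kess; have fR x : range f (f x) by exists x.
have ks := submodule_ker f.
split; first exact: (in_sigma_inj (@submodule_incl_inj _ _ _ _) sN).
(* The exact sequence is that of [ker f], [M] and [f(M)]. *)
exists (submodule_type ks), M, (submodule_incl ks),
  (corestriction (submodule_range f) fR).
have kE : ker_lin (corestriction (submodule_range f) fR) = ker_lin f.
  apply/seteqP; split=> [x /(congr1 val)//|x fx0]; exact: val_inj.
split.
- exact: in_sigma_inj (@submodule_incl_inj _ _ _ _) (in_sigma_self M).
- exact: in_sigma_self.
- split; first exact: submodule_incl_inj.
    by rewrite range_submodule_incl kE.
  apply/seteqP; split=> // y _.
  by have [x _ fxy] := submodule_inclP y; exists x => //; apply: val_inj.
by rewrite range_submodule_incl.
Qed.

Theorem proposition2p15 (R : pzRingType) (M : lmodType R)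
    (progM : progenerator M)
    (semiprimeM : semiprime_module M) (goldieM : goldie_module M)
    (N : lmodType R) (sigmaN : in_sigma M N) :
  singular_submodule M N =
  submodule_sum
    [set A | exists f : {linear M -> N},
       (exists alpha : {linear M -> M},
          [/\ injective_lin alpha, essential (range alpha)
            & forall x, f (alpha x) = 0])
       /\ A = range f].
Proof.
have [accM fdM] := goldieM; have [_ _ genM] := progM.
set F := [set A | exists f : {linear M -> N}, _].
have Fs : submodule (submodule_sum F).
  by apply: submodule_submodule_sum => _ [f [_ ->]]; apply: submodule_range.
apply/seteqP; split=> _ [s sP ->]; apply: submodule_sum_sum => y /sP[A].
  move=> [S [f [[_ [K [L [i [p [_ sL [_ ipE psurj] iess]]]]]] ->]]] [z _ <-].
  have : range p z by rewrite psurj.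
  case=> l _ <-.
  (* As [L] is generated by [M], it suffices to treat [l = h m] with [h] a map from [M] to [L]. *)
  apply: (generator_ind genM (P := fun l => submodule_sum F (f (p l))) sL).
  - by rewrite !linear0; apply: submodule0.
  - by move=> u v Fu Fv; rewrite !linearD; apply: submoduleD.
  (* The preimage under [h] of the essential submodule [range i = ker p] is essential in [M]; a
     monomorphism [c] into it satisfies [p h c = 0]. *)
  move=> h m; have [c cinj cE] :=
    essential_contains_mono accM progM semiprimeM fdM (essential_preimage h iess).
  apply: (@submodule_sum_mem _ _ _ (range (f \o p \o h))); last by exists m.
  exists (f \o p \o h); split=> //; exists c; split=> //.
    exact: injective_lin_essential.
  move=> x; have : range i (h (c x)) by apply: cE; exists x.
  by rewrite ipE /= => ->; rewrite linear0.
move=> [f [[c [cinj cess fc]] ->]] fy.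
pose S := submodule_type (submodule_range f).
apply: (submodule_sum_mem (A := range f)) => //.
exists S, (submodule_incl _); split; last by rewrite range_submodule_incl.
apply: M_singular_range => //; apply: essentialW cess (submodule_ker f) _.
by move=> _ [x _ <-]; apply: fc.
Qed.
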